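(* Let $A$ be a $d_1$-dimensional matrix of order $n$ and let $B$ be a $d_2$-dimensional matrix of order $n$. Then $$\operatorname{per}(A\times B)=n!\,(\operatorname{per}A\cdot\operatorname{per}B),$$ where $A\times B$ denotes the outer product.
   Context: Let $I_n^d = \{1,\ldots,n\}^d$ with $n,d$ positive integers. A $d$-dimensional matrix $A$ of order $n$ is an array $(a_\alpha)_{\alpha\in I_n^d}$ of real numbers. A diagonal in a $d$-dimensional matrix of order $n$ is a set of indices $\{\alpha^1,\ldots,\alpha^n\}\subset I_n^d$ such that $\alpha^i_k\ne\alpha^j_k$ for all $k\in\{1,\ldots,d\}$ and all $i\neq j$. With $\mathcal{D}(A)$ the set of all diagonals, the permanent of $A$ is $\operatorname{per}A=\sum_{D\in\mathcal{D}(A)}\prod_{\alpha\in D}a_\alpha$. The outer product $A\times B$ of a $d_1$-dimensional matrix $A$ and a $d_2$-dimensional matrix $B$, both of order $n$, is the $(d_1+d_2)$-dimensional matrix $C$ of order $n$ with entries $c_{\alpha\beta}=a_\alpha b_\beta$ for $\alpha\in I_n^{d_1}$, $\beta\in I_n^{d_2}$, where $\alpha\beta$ is the concatenation of $\alpha$ and $\beta$. *)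

(* Defs.v *)
From HB Require Import structures.
From mathcomp Require Import all_boot all_order all_algebra.
From mathcomp Require Import reals.

Set Implicit Arguments.
Unset Strict Implicit.
Unset Printing Implicit Defensive.

Import GRing.Theory.
Local Open Scope ring_scope.

(* I_n^d, with {1, ..., n} and {1, ..., d} encoded as 'I_n and 'I_d. *)
Definition mindex (d n : nat) := {ffun 'I_d -> 'I_n}.

Definition mdmatrix (R : realType) (d n : nat) := {ffun mindex d n -> R}.

(* For d > 0 the separation condition makes alpha injective, so such a set D
   has exactly n elements. *)
Definition is_diagonal (d n : nat) (D : {set mindex d n}) : bool :=
  [exists alpha : {ffun 'I_n -> mindex d n},
     (D == [set alpha i | i : 'I_n]) &&
     [forall i, forall j, (i != j) ==> [forall k, alpha i k != alpha j k]]].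

Definition per (R : realType) (d n : nat) (A : mdmatrix R d n) : R :=
  \sum_(D : {set mindex d n} | is_diagonal D) \prod_(alpha in D) A alpha.

Definition concat (d1 d2 n : nat) (alpha : mindex d1 n) (beta : mindex d2 n) :
    mindex (d1 + d2) n :=
  [ffun k => match split k with inl i => alpha i | inr j => beta j end].

Definition lpart (d1 d2 n : nat) (gamma : mindex (d1 + d2) n) : mindex d1 n :=
  [ffun i => gamma (lshift d2 i)].

Definition rpart (d1 d2 n : nat) (gamma : mindex (d1 + d2) n) : mindex d2 n :=
  [ffun j => gamma (rshift d1 j)].

(* Every index of length d1 + d2 is a unique concatenation (concatK), so this
   is the matrix with entries A alpha * B beta at concat alpha beta (outerE). *)
Definition outer (R : realType) (d1 d2 n : nat)
    (A : mdmatrix R d1 n) (B : mdmatrix R d2 n) : mdmatrix R (d1 + d2) n :=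
  [ffun gamma => A (lpart gamma) * B (rpart gamma)].

Lemma concatK (d1 d2 n : nat) (gamma : mindex (d1 + d2) n) :
  concat (lpart gamma) (rpart gamma) = gamma.
Proof.
by apply/ffunP => k; rewrite !ffunE; case: splitP => j kj; rewrite ffunE;
  congr (gamma _); apply/val_inj.
Qed.

Lemma lpart_concat (d1 d2 n : nat) (alpha : mindex d1 n) (beta : mindex d2 n) :
  lpart (concat alpha beta) = alpha.
Proof. by apply/ffunP => i; rewrite !ffunE (unsplitK (inl _ i)). Qed.

Lemma rpart_concat (d1 d2 n : nat) (alpha : mindex d1 n) (beta : mindex d2 n) :
  rpart (concat alpha beta) = beta.
Proof. by apply/ffunP => i; rewrite !ffunE (unsplitK (inr _ i)). Qed.

Lemma outerE (R : realType) (d1 d2 n : nat)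
    (A : mdmatrix R d1 n) (B : mdmatrix R d2 n)
    (alpha : mindex d1 n) (beta : mindex d2 n) :
  outer A B (concat alpha beta) = A alpha * B beta.
Proof. by rewrite ffunE lpart_concat rpart_concat. Qed.

(* Main.v *)
Require Import Defs.
From HB Require Import structures.
From mathcomp Require Import all_boot all_order all_algebra.
From mathcomp Require Import reals.

Set Implicit Arguments.
Unset Strict Implicit.
Unset Printing Implicit Defensive.

Import GRing.Theory.
Local Open Scope ring_scope.

(** A diagonal is an unordered set, and a diagonal of an outer product does not
    split canonically into a pair of diagonals: its two projections lose the
    matching between them. Ordering the diagonals removes this difficulty. In
    positive dimension a diagonal has exactly n elements, so it has n! orderings
    and n! per A is the sum of the products of A over all ordered diagonals
    ([sum_separated]). An ordered diagonal of dimension d1 + d2 is the same as a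
    pair of ordered diagonals of dimensions d1 and d2, by cutting every index in
    two ([separated_concat]), and the product of the entries of the outer product
    factors accordingly. Hence n! per (A x B) = (n! per A) (n! per B), and one
    factor n! cancels. *)

Definition separated (d n : nat) (alpha : {ffun 'I_n -> mindex d n}) : bool :=
  [forall i, forall j, (i != j) ==> [forall k, alpha i k != alpha j k]].

Lemma separatedP (d n : nat) (alpha : {ffun 'I_n -> mindex d n}) :
  reflect (forall i j, i != j -> forall k, alpha i k != alpha j k)
          (separated alpha).
Proof.
apply: (iffP forallP) => [sep i j ij k | sep i].
  by move/forallP/(_ j)/implyP/(_ ij)/forallP: (sep i).
by apply/forallP => j; apply/implyP => ij; apply/forallP => k; apply: sep.
Qed.

Lemma separated_inj (d n : nat) (alpha : {ffun 'I_n -> mindex d n}) :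
  (0 < d)%N -> separated alpha -> injective alpha.
Proof.
move=> d_gt0 /separatedP sep i j eq_ij; apply/eqP/negPn/negP => ij.
by have := sep i j ij (Ordinal d_gt0); rewrite eq_ij eqxx.
Qed.

Lemma card_diagonal (d n : nat) (D : {set mindex d n}) :
  (0 < d)%N -> is_diagonal D -> #|D| = n.
Proof.
move=> d_gt0 /existsP [delta /andP [/eqP -> sep]].
by rewrite card_imset ?card_ord //; apply: separated_inj sep.
Qed.

(** For an injective enumeration, separation is a condition on the image alone:
    its distinct elements differ in every coordinate. A diagonal satisfies it,
    and an injection of 'I_n into the n elements of a diagonal is onto, so the
    orderings of a diagonal are counted by [card_inj_ffuns_on]. *)
Lemma separated_enumeration (d n : nat) (D : {set mindex d n})
    (alpha : {ffun 'I_n -> mindex d n}) :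
  (0 < d)%N -> is_diagonal D ->
  (separated alpha && ([set alpha i | i : 'I_n] == D)) =
  (alpha \in ffun_on (mem D)) && injectiveb alpha.
Proof.
move=> d_gt0 diagD; have cardD := card_diagonal d_gt0 diagD.
have /existsP [delta /andP [/eqP defD sep_delta]] := diagD.
apply/andP/andP => [[sep /eqP imD] | [/ffun_onP alphaD /injectiveP inj]].
  split; last by apply/injectiveP/separated_inj.
  by apply/ffun_onP => i; rewrite -imD imset_f.
split; last first.
  rewrite eqEcard (card_imset _ inj) card_ord cardD leqnn andbT.
  by apply/subsetP => _ /imsetP [i _ ->]; apply: alphaD.
apply/separatedP => i j ij k.
have := alphaD i; have := alphaD j; rewrite /= defD.
move=> /imsetP [j' _ aj] /imsetP [i' _ ai]; rewrite ai aj.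
move/separatedP: sep_delta; apply; apply: contraNneq ij => eq_ij'.
by apply/eqP/inj; rewrite ai aj eq_ij'.
Qed.

Lemma card_separated_enumerations (d n : nat) (D : {set mindex d n}) :
  (0 < d)%N -> is_diagonal D ->
  #|[pred alpha : {ffun 'I_n -> mindex d n} |
      separated alpha && ([set alpha i | i : 'I_n] == D)]| = n`!.
Proof.
move=> d_gt0 diagD.
transitivity (#|D| ^_ #|'I_n|).
  rewrite -card_inj_ffuns_on; apply: eq_card => alpha.
  by rewrite !inE separated_enumeration.
by rewrite (card_diagonal d_gt0 diagD) card_ord ffactnn.
Qed.

(** Grouping the separated enumerations by their image gives n! equal terms for
    each diagonal. Positive dimension matters: for d = 0 there is only one
    enumeration, constant and vacuously separated, so the count n! fails as
    soon as n > 1. *)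
Lemma sum_separated (R : realType) (d n : nat) (A : mdmatrix R d n) :
  (0 < d)%N ->
  \sum_(alpha : {ffun 'I_n -> mindex d n} | separated alpha)
     \prod_i A (alpha i) = (n`!)%:R * per A.
Proof.
move=> d_gt0.
rewrite (partition_big
  (fun alpha : {ffun 'I_n -> mindex d n} => [set alpha i | i : 'I_n])
  (@is_diagonal d n)) /=; last first.
  by move=> alpha sep; apply/existsP; exists alpha; rewrite eqxx.
rewrite /per big_distrr /=; apply: eq_bigr => D diagD.
transitivity (\sum_(alpha : {ffun 'I_n -> mindex d n} |
    separated alpha && ([set alpha i | i : 'I_n] == D)) \prod_(a in D) A a).
  apply: eq_bigr => alpha /andP [sep /eqP <-].
  by rewrite big_imset //= => i j _ _; apply: separated_inj sep i j.
by rewrite sumr_const card_separated_enumerations // mulr_natl.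
Qed.

Lemma separated_concat (d1 d2 n : nat)
    (alpha : {ffun 'I_n -> mindex d1 n}) (beta : {ffun 'I_n -> mindex d2 n}) :
  separated [ffun i => concat (alpha i) (beta i)] =
  separated alpha && separated beta.
Proof.
apply/separatedP/andP => [sep | [/separatedP sepa /separatedP sepb] i j ij k].
  split; apply/separatedP => i j ij k.
    have := sep i j ij (lshift d2 k).
    by rewrite !ffunE (unsplitK (inl _ k)).
  have := sep i j ij (rshift d1 k).
  by rewrite !ffunE (unsplitK (inr _ k)).
by rewrite !ffunE; case: (split k) => l; [apply: sepa | apply: sepb].
Qed.

Lemma sum_separated_outer (R : realType) (d1 d2 n : nat)
    (A : mdmatrix R d1 n) (B : mdmatrix R d2 n) :
  \sum_(gamma : {ffun 'I_n -> mindex (d1 + d2) n} | separated gamma)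
     \prod_i outer A B (gamma i) =
  (\sum_(alpha : {ffun 'I_n -> mindex d1 n} | separated alpha)
     \prod_i A (alpha i)) *
  (\sum_(beta : {ffun 'I_n -> mindex d2 n} | separated beta)
     \prod_i B (beta i)).
Proof.
rewrite big_distrlr pair_big /=.
pose join (p : {ffun 'I_n -> mindex d1 n} * {ffun 'I_n -> mindex d2 n}) :=
  [ffun i => concat (p.1 i) (p.2 i)].
have joinE p i : join p i = concat (p.1 i) (p.2 i) by rewrite ffunE.
pose cut (gamma : {ffun 'I_n -> mindex (d1 + d2) n}) :=
  ([ffun i => lpart (gamma i)], [ffun i => rpart (gamma i)]).
rewrite (reindex join) /=; last first.
  exists cut => [[alpha beta] _ | gamma _].
    congr pair; apply/ffunP => i; rewrite !ffunE /=.
      exact: lpart_concat.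
    exact: rpart_concat.
  by apply/ffunP => i; rewrite !ffunE; apply: concatK.
apply: eq_big => [p | p _]; first exact: separated_concat.
by rewrite -big_split /=; apply: eq_bigr => i _; rewrite joinE outerE.
Qed.

Theorem theorem7 (R : realType) (n d1 d2 : nat)
    (hn : (0 < n)%N) (hd1 : (0 < d1)%N) (hd2 : (0 < d2)%N)
    (A : mdmatrix R d1 n) (B : mdmatrix R d2 n) :
  per (outer A B) = (n`!)%:R * (per A * per B).
Proof.
have fact_neq0 : (n`!)%:R != 0 :> R.
  by rewrite Num.Theory.pnatr_eq0 -lt0n fact_gt0.
apply: (mulfI fact_neq0).
rewrite -sum_separated ?addn_gt0 ?hd1 // sum_separated_outer !sum_separated //.
by rewrite mulrACA -mulrA.
Qed.
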